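(* Let $(\mathcal{M},(\cdot,\cdot))$ be a $d$-dimensional Riemannian manifold, let $\mathbf{p}\in\mathcal{M}$, let $\mathcal{X}\in\mathcal{M}^{d_1\times\cdots\times d_n}$ be a manifold-valued tensor for which $\log_{\mathbf{p}}\mathcal{X}$ is well-defined, and let $\{\Theta_{\mathbf{p}}^{j_1,\ldots,j_n,j}\}_{j_1,\ldots,j_n,j=1}^{d_1,\ldots,d_n,d}$ be a fixed orthonormal basis of $T_{\mathbf{p}}\mathcal{M}^{d_1\times\cdots\times d_n}$. For $\kappa\in\mathbb{R}^{d_1\times\cdots\times d_n\times d}$ define $F(\,\cdot\,;\kappa):T_{\mathbf{p}}\mathcal{M}^{d_1\times\cdots\times d_n}\to\mathbb{R}$ by $$F(\Xi_{\mathbf{p}};\kappa):=\sum_{j_1,\ldots,j_n,j=1}^{d_1,\ldots,d_n,d}\beta(\kappa_{j_1,\ldots,j_n,j})^2\bigl(\Xi_{\mathbf{p}}-\log_{\mathbf{p}}\mathcal{X},\Theta_{\mathbf{p}}^{j_1,\ldots,j_n,j}\bigr)_{\mathbf{p}}^2 .$$ Let $\kappa\in\mathbb{R}^{d_1\times\cdots\times d_n\times d}$ be any real-valued tensor such that $\kappa_{j_1,\ldots,j_n,j}\le\pi^2$ for all indices. Then for any $\Xi_{\mathbf{p}}\in T_{\mathbf{p}}\mathcal{M}^{d_1\times\cdots\times d_n}$, $$F(\Xi_{\mathbf{p}};\kappa)\ge\beta(\kappa_{\max})^2\,F(\Xi_{\mathbf{p}};0),$$ where $\kappa_{\max}:=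\max_{j_1,\ldots,j_n,j}\kappa_{j_1,\ldots,j_n,j}$.
   Context: $\mathcal{M}^{d_1\times\cdots\times d_n}$ is the space of arrays $\mathcal{X}=(\mathcal{X}_{i_1,\ldots,i_n})$, $1\le i_k\le d_k$, with entries in $\mathcal{M}$, with the product Riemannian metric. $T_{\mathbf{p}}\mathcal{M}^{d_1\times\cdots\times d_n}:=(T_{\mathbf{p}}\mathcal{M})^{d_1\times\cdots\times d_n}$ carries the product inner product $(\cdot,\cdot)_{\mathbf{p}}$ (sum of entrywise inner products) and norm $\|\cdot\|_{\mathbf{p}}$. $\log_{\mathbf{p}}$ acts entrywise; it is the inverse of $\exp_{\mathbf{p}}$ restricted to a set $\mathcal{G}'_{\mathbf{p}}\subset T_{\mathbf{p}}\mathcal{M}$ on which $\exp_{\mathbf{p}}$ is a diffeomorphism onto its image, and $\log_{\mathbf{p}}\mathcal{X}$ is well-defined when all entries of $\mathcal{X}$ lie in $\exp_{\mathbf{p}}(\mathcal{G}'_{\mathbf{p}})$. The function $\beta:\mathbb{R}\to\mathbb{R}$ is $$\beta(\kappa):=\begin{cases}\sinh(\sqrt{-\kappa})/\sqrt{-\kappa}, & \kappa<0,\\ 1, & \kappa=0,\\ \sin(\sqrt{\kappa})/\sqrt{\kappa}, & \kappa>0.\end{cases}$$ *)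

(* Defs.v *)
From HB Require Import structures.
From mathcomp Require Import all_boot all_order all_algebra.
From mathcomp Require Import all_classical all_reals all_analysis.

Set Implicit Arguments.
Unset Strict Implicit.
Unset Printing Implicit Defensive.

Import Order.TTheory GRing.Theory Num.Theory.
Import numFieldNormedType.Exports.

Local Open Scope classical_set_scope.
Local Open Scope ring_scope.

(** * Smooth maps between normed spaces (the domain is always some R^m) *)

Section Smooth.
Context {R : realType} {V W : normedModType R}.

(* For [U] open and [V] finite dimensional this is the class C^n: all iterated
   directional derivatives up to order [n] exist and are continuous on [U]. *)
Fixpoint Cn (n : nat) (U : set V) (f : V -> W) : Prop :=
  match n with
  | 0 => forall x, U x -> {for x, continuous f}
  | n'.+1 => forall v, (forall x, U x -> derivable f x v) /\
                       Cn n' U (fun x => 'D_v f x)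
  end.

(* [S] need not be open: as usual, smoothness on [S] means that [f] has local
   C^oo extensions around the points of [S]. *)
Definition smooth_on (S : set V) (f : V -> W) : Prop :=
  forall x, S x -> exists (U : set V) (g : V -> W),
    [/\ open U, U x, forall n, Cn n U g & forall y, S y -> U y -> g y = f y].

End Smooth.

(** * Smooth manifolds, Riemannian metrics *)

(* [chart_at p] is a chosen chart around [p], used to represent tangent vectors
   at [p].  [chart_inv c] is the inverse of [chart_map c]; both are total functions,
   meaningful on [chart_dom c] and [chart_map c @` chart_dom c] only. *)
Record manifold (R : realType) (d : nat) := Manifold {
  carrier :> topologicalType;
  chart : Type;
  chart_dom : chart -> set carrier;
  chart_map : chart -> carrier -> 'rV[R]_d;
  chart_inv : chart -> 'rV[R]_d -> carrier;
  chart_at : carrier -> chart;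
  manifold_hausdorff : hausdorff_space carrier;
  manifold_second_countable : @second_countable carrier;
  dom_open : forall c, open (chart_dom c);
  range_open : forall c, open (chart_map c @` chart_dom c);
  chart_mapK : forall c p, chart_dom c p -> chart_inv c (chart_map c p) = p;
  chart_map_continuous : forall c p, chart_dom c p -> {for p, continuous (chart_map c)};
  chart_inv_continuous : forall c x, (chart_map c @` chart_dom c) x ->
    {for x, continuous (chart_inv c)};
  transition_smooth : forall c c',
    smooth_on (chart_map c @` (chart_dom c `&` chart_dom c')) (chart_map c' \o chart_inv c);
  dom_chart_at : forall p, chart_dom (chart_at p) p
}.

Arguments chart {R d} m.
Arguments chart_dom {R d m} c.
Arguments chart_map {R d m} c.
Arguments chart_inv {R d m} c.
Arguments chart_at {R d m} p.

(* T_p M: a tangent vector is represented by its components with respect to the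
   coordinate frame at [p] of the chart [chart_at p]. *)
Definition tangent (R : realType) (d : nat) (M : manifold R d) (p : M) : Type :=
  'rV[R]_d.

HB.instance Definition _ (R : realType) (d : nat) (M : manifold R d) (p : M) :=
  NormedModule.copy (tangent p) 'rV[R]_d.
HB.instance Definition _ (R : realType) (d : nat) (M : manifold R d) (p : M) :=
  Vector.copy (tangent p) 'rV[R]_d.

(* The coordinate vector field d/dx^a of the chart [c], at the point with
   coordinates [x]: the [a]-th column of the Jacobian of the transition map
   from [c] to the chart representing the tangent space at that point. *)
Definition frame (R : realType) (d : nat) (M : manifold R d) (c : chart M)
    (a : 'I_d) (x : 'rV[R]_d) : tangent (chart_inv c x) :=
  'D_(delta_mx 0 a : 'rV[R]_d) (chart_map (chart_at (chart_inv c x)) \o chart_inv c) x.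

Record riemannianManifold (R : realType) (d : nat) := RiemannianManifold {
  base_manifold :> manifold R d;
  metric : forall p : base_manifold, tangent p -> tangent p -> R;
  metricC : forall p (u v : tangent p), metric u v = metric v u;
  metric_linear : forall p (a : R) (u v w : tangent p),
    metric (a *: u + v) w = a * metric u w + metric v w;
  metric_pos : forall p (u : tangent p), u != 0 -> 0 < metric u u;
  metric_smooth : forall (c : chart base_manifold) (a b : 'I_d),
    smooth_on (chart_map c @` chart_dom c)
      (fun x => metric (frame c a x) (frame c b x) : R^o)
}.

(** * Geodesics, exponential map, logarithm *)

Section Exponential.
Context {R : realType} {d : nat} (M : riemannianManifold R d).

Definition metric_mx (c : chart M) (x : 'rV[R]_d) : 'M[R]_d :=
  \matrix_(a, b) metric (frame c a x) (frame c b x).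

Definition dmetric (c : chart M) (x : 'rV[R]_d) (l a b : 'I_d) : R :=
  'D_(delta_mx 0 l : 'rV[R]_d) (fun y => metric_mx c y a b : R^o) x.

(* The Christoffel symbols of the Levi-Civita connection in the chart [c]. *)
Definition christoffel (c : chart M) (x : 'rV[R]_d) (k a b : 'I_d) : R :=
  2^-1 * \sum_l invmx (metric_mx c x) k l *
    (dmetric c x a l b + dmetric c x b l a - dmetric c x l a b).

Definition geodesic_on (J : set R) (g : R -> M) : Prop :=
  forall t, J t -> {for t, continuous g} /\
    forall c : chart M, chart_dom c (g t) ->
      let x : R^o -> 'rV[R]_d := chart_map c \o g in
      let x' : R^o -> 'rV[R]_d := derive1 x in
      [/\ derivable x t 1, derivable x' t 1 &
        forall k, derive1 x' t 0 k
          + \sum_a \sum_b christoffel c (x t) k a b * x' t 0 a * x' t 0 b = 0].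

Variable p : M.

(* [q] is the value at time 1 of a geodesic issued from [p] with velocity [v]. *)
Definition is_exp (v : tangent p) (q : M) : Prop :=
  exists (e : R) (g : R -> M),
    [/\ 0 < e, geodesic_on `](- e), (1 + e)[ g, g 0 = p,
        derive1 (chart_map (chart_at p) \o g : R^o -> 'rV[R]_d) 0 = v &
        g 1 = q].

Definition exp_dom : set (tangent p) := [set v | exists q, is_exp v q].

(* The default value [p] is irrelevant: it is only used outside [exp_dom]. *)
Definition exp_at (v : tangent p) : M := xget p [set q | is_exp v q].

(* log_p, the inverse of exp_p restricted to [G], defined on exp_p(G). *)
Definition log_at (G : set (tangent p)) : M -> tangent p := pinv G exp_at.

Definition exp_diffeo_on (G : set (tangent p)) : Prop :=
  [/\ G `<=` exp_dom,
      {in G &, injective exp_at},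
      {within G, continuous exp_at},
      forall c : chart M, smooth_on (G `&` exp_at @^-1` chart_dom c)
        (chart_map c \o exp_at : tangent p -> 'rV[R]_d) &
      forall c : chart M, smooth_on (chart_map c @` (chart_dom c `&` exp_at @` G))
        (log_at G \o chart_inv c)].

End Exponential.

(** * Manifold-valued and tangent-space-valued tensors *)

(* [n]-fold multi-indices of shape [dims]. *)
Definition midx (n : nat) (dims : 'I_n -> nat) : finType :=
  {dffun forall k : 'I_n, 'I_(dims k)}.

Notation tensor dims T := {ffun midx dims -> T}.

(* Arrays of shape d_1 x ... x d_n x d. *)
Notation curvature_tensor R dims d := {ffun (midx dims * 'I_d)%type -> R}.

Section Tensors.
Context {R : realType} {d : nat} {M : riemannianManifold R d} {p : M}.
Context {n : nat} {dims : 'I_n -> nat}.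

Definition tensor_log (G : set (tangent p)) (X : tensor dims M) :
    tensor dims (tangent p) :=
  [ffun i => log_at G (X i)].

Definition tensor_inner (A B : tensor dims (tangent p)) : R :=
  \sum_i metric (A i) (B i).

Definition orthonormal_basis
    (Theta : midx dims * 'I_d -> tensor dims (tangent p)) : Prop :=
  basis_of fullv (codom Theta) /\
  forall j j', tensor_inner (Theta j) (Theta j') = (j == j')%:R.

End Tensors.

Definition beta {R : realType} (kappa : R) : R :=
  if kappa < 0 then
    let s := Num.sqrt (- kappa) in (expR s - expR (- s)) / 2 / s
  else if kappa == 0 then 1
  else sin (Num.sqrt kappa) / Num.sqrt kappa.

Definition Fbeta {R : realType} {d : nat} {M : riemannianManifold R d} {p : M}
    {n : nat} {dims : 'I_n -> nat} (G : set (tangent p)) (X : tensor dims M)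
    (Theta : midx dims * 'I_d -> tensor dims (tangent p))
    (Xi : tensor dims (tangent p)) (kappa : curvature_tensor R dims d) : R :=
  \sum_j beta (kappa j) ^+ 2 *
    tensor_inner (Xi - tensor_log G X) (Theta j) ^+ 2.

(* The maximum of all entries; the fold is seeded with the first entry, which
   exists because all dimensions are positive. *)
Definition kappa_max {R : realType} {d n : nat} {dims : 'I_n -> nat}
    (d_gt0 : (0 < d)%N) (dims_gt0 : forall k, (0 < dims k)%N)
    (kappa : curvature_tensor R dims d) : R :=
  let i0 : midx dims := [ffun k => Ordinal (dims_gt0 k)] in
  \big[Num.max/kappa (i0, Ordinal d_gt0)]_j kappa j.

(* Main.v *)
(* The functions sin and -sinh vanish at 0 and have a nonincreasing derivative
   (on [0, pi], resp. on [0, +oo[), so by the mean value theorem the slope of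
   their chords from 0 is nonincreasing.  Hence beta is nonincreasing and
   nonnegative on ]-oo, pi^2], and since beta 0 = 1 the claim holds termwise. *)

Require Import Defs.
From mathcomp Require Import all_boot all_order all_algebra.
From mathcomp Require Import all_classical all_reals all_analysis.
From mathcomp Require Import ring lra.

Set Implicit Arguments.
Unset Strict Implicit.
Unset Printing Implicit Defensive.

Import Order.TTheory GRing.Theory Num.Theory.
Import numFieldNormedType.Exports.

Local Open Scope classical_set_scope.
Local Open Scope ring_scope.

Section ChordSlope.
Context {R : realType} (f df : R -> R) (b : R).
Hypothesis f_derive : forall x : R, is_derive x 1 f (df x).
Hypothesis f0 : f 0 = 0.
Hypothesis df_nonincr : {in `[0, b] &, {homo df : x y /~ x <= y}}.

Let mean_value (x y : R) : x <= y ->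
  exists2 c, x <= c <= y & f y - f x = df c * (y - x).
Proof.
move=> xy; have [|c /[!in_itv]/= cxy fxy] := @MVT_segment R f df x y xy
  (fun z _ => f_derive z).
  apply: continuous_subspaceT => z.
  apply/differentiable_continuous/derivable1_diffP.
  by have [] := f_derive z.
by exists c.
Qed.

(** The chord has slope [df c] for some [c] in [[0, x]]. This serves the comparisons with
    [beta 0 = 1]. *)
Lemma chord_slope_le_derive0 (x : R) : 0 < x -> x <= b -> f x / x <= df 0.
Proof.
move=> x_gt0 xb; have [c /andP[c0 cx]] := mean_value (ltW x_gt0).
rewrite f0 !subr0 => ->; rewrite mulfK ?gt_eqF//.
by apply: df_nonincr; rewrite // in_itv/= ?lexx; lra.
Qed.

(** With [c <= x <= e] from the mean value theorem on [[0, x]] and [[x, y]], the slope over [[0, y]]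
    is the average of [df c] and [df e] weighted by the lengths, hence at most [df c = f x / x]. *)
Lemma chord_slope_nonincreasing (x y : R) :
  0 < x -> x <= y -> y <= b -> f y / y <= f x / x.
Proof.
move=> x_gt0 xy yb; have y_gt0 := lt_le_trans x_gt0 xy.
have [c /andP[c0 cx]] := mean_value (ltW x_gt0).
have [e /andP[xe ey]] := mean_value xy.
have dfec : df e <= df c by apply: df_nonincr; rewrite // ?in_itv/=; lra.
rewrite f0 !subr0 => /eqP; rewrite subr_eq => /eqP -> ->.
rewrite mulfK ?gt_eqF// ler_pdivrMr//.
by have := ler_wpM2r (_ : 0 <= y - x) dfec; rewrite subr_ge0 => /(_ xy); lra.
Qed.

End ChordSlope.

Section Beta.
Context {R : realType}.
Implicit Types x y s t : R.

Lemma cos_nonincreasing : {in `[0, pi] &, {homo @cos R : x y /~ x <= y}}.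
Proof. by move=> x y x0pi y0pi yx; rewrite leNgt ltr_cos// -leNgt. Qed.

Lemma sinc_le1 s : 0 < s -> s <= pi -> sin s / s <= 1.
Proof.
move=> s0 spi; rewrite -(@cos0 R).
exact: (chord_slope_le_derive0 _ (@sin0 R) cos_nonincreasing s0 spi).
Qed.

Lemma sinc_nonincreasing s t :
  0 < s -> s <= t -> t <= pi -> sin t / t <= sin s / s.
Proof.
exact: (chord_slope_nonincreasing _ (@sin0 R) cos_nonincreasing).
Qed.

Let Nsinh s : R := (expR (- s) - expR s) / 2.
Let Ncosh s : R := - (expR (- s) + expR s) / 2.

Let is_derive_Nsinh s : is_derive s 1 Nsinh (Ncosh s).
Proof.
rewrite /Nsinh; apply: is_derive_eq.
by rewrite /Ncosh /GRing.scale/=; lra.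
Qed.

Let Nsinh0 : Nsinh 0 = 0.
Proof. by rewrite /Nsinh oppr0 subrr mul0r. Qed.

Let Ncosh_nonincreasing b : {in `[0, b] &, {homo Ncosh : x y /~ x <= y}}.
Proof.
move=> y x /[!in_itv]/= /andP[y0 _] /andP[x0 _] xy.
rewrite /Ncosh !expRN.
have a1 : 1 <= expR x by rewrite -expR0 ler_expR.
have ab : expR x <= expR y by rewrite ler_expR.
set a := expR x in a1 ab *; set c := expR y in ab *.
have a_neq0 : a != 0 by rewrite gt_eqF// expR_gt0.
have c_neq0 : c != 0 by rewrite gt_eqF// expR_gt0.
(* The hyperbolic cosines at [y] and [x] differ by half of a product whose two factors are
   nonnegative, since [1 <= a <= c]. *)
have -> : - (c^-1 + c) / 2 = - (a^-1 + a) / 2 - (c - a) * (1 - (a * c)^-1) / 2.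
  by field; apply/andP.
have : 0 <= (c - a) * (1 - (a * c)^-1).
  rewrite mulr_ge0 ?subr_ge0// invf_le1; first by nra.
  by rewrite mulr_gt0 ?expR_gt0.
lra.
Qed.

(** Since [Ncosh 0 = -1], undoing the sign of [Nsinh] turns the upper bound on its chord slope into
    this lower bound. *)
Lemma sinhc_ge1 s : 0 < s -> 1 <= (expR s - expR (- s)) / 2 / s.
Proof.
move=> s0.
have := chord_slope_le_derive0 is_derive_Nsinh Nsinh0
  (@Ncosh_nonincreasing s) s0 (lexx s).
by rewrite /Nsinh /Ncosh oppr0 expR0; lra.
Qed.

Lemma sinhc_nondecreasing s t : 0 < s -> s <= t ->
  (expR s - expR (- s)) / 2 / s <= (expR t - expR (- t)) / 2 / t.
Proof.
move=> s0 st.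
have := chord_slope_nonincreasing is_derive_Nsinh Nsinh0
  (@Ncosh_nonincreasing t) s0 st (lexx t).
by rewrite /Nsinh; lra.
Qed.

Lemma beta0 : beta 0 = 1 :> R.
Proof. by rewrite /beta ltxx eqxx. Qed.

Lemma sqrt_le_pi x : x <= pi ^+ 2 -> Num.sqrt x <= pi.
Proof.
move=> xpi; rewrite -[leRHS]ger0_norm ?pi_ge0// -sqrtr_sqr.
exact: ler_wsqrtr.
Qed.

(** For positive [x], the bound [pi ^+ 2] keeps the square root in [[0, pi]], where the sine is
    nonnegative. *)
Lemma beta_ge0 x : x <= pi ^+ 2 -> 0 <= beta x.
Proof.
move=> xpi; rewrite /beta; case: (ltrgtP x 0) => [x0|x0|_]; last exact: ler01.
- by rewrite (le_trans ler01)// sinhc_ge1// sqrtr_gt0 oppr_gt0.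
- by rewrite divr_ge0 ?sqrtr_ge0// sin_ge0_pi// sqrtr_ge0 sqrt_le_pi.
Qed.

Lemma beta_nonincreasing x y : x <= y -> y <= pi ^+ 2 -> beta y <= beta x.
Proof.
move=> xy ypi; rewrite /beta.
(* Between negative arguments, [x |-> sqrt (- x)] reverses the order, so the growth of sinh(s)/s
   makes [beta] decrease. Across 0, the value 1 separates the two sides. *)
case: (ltrgtP x 0) => x0; case: (ltrgtP y 0) => y0; rewrite /=; try lra.
- apply: sinhc_nondecreasing; first by rewrite sqrtr_gt0 oppr_gt0.
  by rewrite ler_wsqrtr ?lerN2.
- apply: (@le_trans _ _ 1).
    by rewrite sinc_le1 ?sqrtr_gt0// sqrt_le_pi.
  by rewrite sinhc_ge1// sqrtr_gt0 oppr_gt0.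
- by rewrite sinhc_ge1// sqrtr_gt0 oppr_gt0.
- by apply: sinc_nonincreasing; rewrite ?sqrtr_gt0 ?sqrt_le_pi ?ler_wsqrtr.
- by rewrite sinc_le1 ?sqrtr_gt0// sqrt_le_pi.
Qed.

End Beta.

Theorem lemma4p1 (R : realType) (d : nat) (d_gt0 : (0 < d)%N)
    (M : riemannianManifold R d) (p : M)
    (G : set (tangent p)) (hG : exp_diffeo_on G)
    (n : nat) (dims : 'I_n -> nat) (dims_gt0 : forall k, (0 < dims k)%N)
    (X : tensor dims M) (hX : forall i, (@exp_at R d M p @` G) (X i))
    (Theta : midx dims * 'I_d -> tensor dims (tangent p))
    (hTheta : orthonormal_basis Theta)
    (kappa : curvature_tensor R dims d)
    (hkappa : forall j, kappa j <= pi ^+ 2)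
    (Xi : tensor dims (tangent p)) :
  Fbeta G X Theta Xi kappa >=
    beta (kappa_max d_gt0 dims_gt0 kappa) ^+ 2 * Fbeta G X Theta Xi 0.
Proof.
rewrite /Fbeta mulr_sumr; apply: ler_sum => j _.
rewrite ffunE beta0 expr1n mul1r ler_wpM2r ?sqr_ge0//.
(* The seed of the maximum is itself an entry of [kappa], so [hkappa] bounds it too. *)
have kmax_le : kappa_max d_gt0 dims_gt0 kappa <= pi ^+ 2.
  exact: bigmax_le.
(* Both values of [beta] are nonnegative, so their squares compare as they do. *)
by rewrite ler_sqr ?nnegrE ?beta_ge0 ?beta_nonincreasing//; exact: le_bigmax.
Qed.
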